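(* The closure ordinals of the immediate derivability operators $\underline{\mathscr{D}}^-$ (of $!\underline{\mathbf{ACT}}_\omega^-$) and $\mathscr{D}^-$ (of $!\mathbf{ACT}_\omega^-$) are both less than or equal to $\omega^\omega$.
   Context: Formulas are built from a countable set of variables and constants $0,1$ using binary $\backslash$, $/$, $\cdot$, $\oplus$, $\&$, unary postfix ${}^*$ and unary prefix $!$. A sequent is $\Pi\Rightarrow B$ ($\Pi$ a finite, possibly empty, sequence of formulas); $A^n$ is $n$ copies of $A$; $!\Pi$ is a sequence of formulas of the form $!A$. The cut-free calculus for infinitary action logic with exponentiation has axioms $A\Rightarrow A$, $\ \Rightarrow1$, $\ \Gamma,0,\Delta\Rightarrow C$, $\ \Rightarrow A^*$ and rules (premises / conclusion): ($\backslash L$) $\Pi\Rightarrow A$, $\Gamma,B,\Delta\Rightarrow C$ / $\Gamma,\Pi,A\backslash B,\Delta\Rightarrow C$; ($\backslash R$) $A,\Pi\Rightarrow B$ / $\Pi\Rightarrow A\backslash B$; ($/L$) $\Pi\Rightarrow A$, $\Gamma,B,\Delta\Rightarrow C$ / $\Gamma,B/A,\Pi,\Delta\Rightarrow C$; ($/R$) $\Pi,A\Rightarrow B$ / $\Pi\Rightarrow B/A$; ($\cdot L$) $\Gamma,A,B,\Delta\Rightarrow C$ / $\Gamma,A\cdot B,\Delta\Rightarrow C$; ($\cdot R$) $\Gamma\Rightarrow A$, $\Delta\Rightarrow B$ / $\Gamma,\Delta\Rightarrow A\cdot B$; ($1L$) $\Gamma,\Delta\Rightarrow C$ / $\Gamma,1,\Delta\Rightarrow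 C$; ($\oplus L$) $\Gamma,A_1,\Delta\Rightarrow C$, $\Gamma,A_2,\Delta\Rightarrow C$ / $\Gamma,A_1\oplus A_2,\Delta\Rightarrow C$; ($\oplus R_i$) $\Pi\Rightarrow A_i$ / $\Pi\Rightarrow A_1\oplus A_2$; ($\&L_i$) $\Gamma,A_i,\Delta\Rightarrow C$ / $\Gamma,A_1\&A_2,\Delta\Rightarrow C$; ($\&R$) $\Pi\Rightarrow A_1$, $\Pi\Rightarrow A_2$ / $\Pi\Rightarrow A_1\&A_2$; (${}^*L_\omega$) $(\Gamma,A^n,\Delta\Rightarrow C)_{n\in\omega}$ / $\Gamma,A^*,\Delta\Rightarrow C$; (${}^*R_n$, $n\ge1$) $\Pi_1\Rightarrow A,\dots,\Pi_n\Rightarrow A$ / $\Pi_1,\dots,\Pi_n\Rightarrow A^*$; ($!L$) $\Gamma,A,\Delta\Rightarrow C$ / $\Gamma,!A,\Delta\Rightarrow C$; ($!R$) $!\Pi\Rightarrow B$ / $!\Pi\Rightarrow!B$; ($!P_1$) $\Gamma,\Pi,!A,\Delta\Rightarrow C$ / $\Gamma,!A,\Pi,\Delta\Rightarrow C$; ($!P_2$) $\Gamma,!A,\Pi,\Delta\Rightarrow C$ / $\Gamma,\Pi,!A,\Delta\Rightarrow C$; ($!W$) $\Gamma,\Delta\Rightarrow C$ / $\Gamma,!A,\Delta\Rightarrow C$; ($!C$) $\Gamma,!A,!A,\Delta\Rightarrow C$ / $\Gamma,!A,\Delta\Rightarrow C$. The calculus $!\mathbf{ACT}_\omega^-$ is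 this calculus restricted to sequents in which every subformula $!B$ has $B$ free of ${}^*$. The calculus $!\underline{\mathbf{ACT}}_\omega^-$ (on the same sequents) has exactly two rules: the rule (${}^*L_\omega$) and the rule (Fin), by which $s$ may be inferred from $s_1,\dots,s_m$ ($m\ge0$) iff $s$ is derivable from $s_1,\dots,s_m$ in $!\mathbf{ACT}_\omega^-$ without using (${}^*L_\omega$). The immediate derivability operator $\mathscr{D}_{\mathbf L}$ of a calculus $\mathbf L$ maps a set $S$ of sequents to the set of sequents that belong to $S$ or are obtained from members of $S$ by one application of a rule of $\mathbf L$ (axioms count as rules without premises); $\mathscr{D}^-$ and $\underline{\mathscr{D}}^-$ denote these operators for $!\mathbf{ACT}_\omega^-$ and $!\underline{\mathbf{ACT}}_\omega^-$. For a monotone operator $F$ on sets, $F^0(S)=S$, $F^{\alpha+1}(S)=F(F^\alpha(S))$, $F^\lambda(S)=\bigcup_{\beta<\lambda}F^\beta(S)$ for nonzero limit $\lambda$; the closure ordinal of $F$ is the least ordinal $\alpha$ with $F^{\alpha+1}(\varnothing)=F^\alpha(\varnothing)$. *)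

(* Defs.v *)
From HB Require Import structures.
From mathcomp Require Import all_boot ssralg poly.
From mathcomp Require Import boolp classical_sets.

Set Implicit Arguments.
Unset Strict Implicit.
Unset Printing Implicit Defensive.

Import GRing.Theory.

Local Open Scope classical_set_scope.

(* [Under A B] is A \ B and [Over B A] is B / A. *)
Inductive formula : Type :=
| Var of nat
| Zero
| One
| Under of formula & formula
| Over of formula & formula
| Prod of formula & formula
| Plus of formula & formula
| With of formula & formula
| Star of formula
| Bang of formula.

Lemma formula_comparable : comparable formula.
Proof. by move=> A B; rewrite /decidable; decide equality; decide equality. Qed.

HB.instance Definition _ := hasDecEq.Build formula (compareP formula_comparable).

Definition sequent : Type := (seq formula * formula)%type.

Notation "Pi ⊢ B" := ((Pi, B) : sequent) (at level 70, no associativity).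

(* All rules other than the left rule for the iteration star, as
   (list of premises, conclusion); axioms are rules without premises. *)
Inductive finitary_rule : seq sequent -> sequent -> Prop :=
| Ax A :
    finitary_rule [::] ([:: A] ⊢ A)
| OneR :
    finitary_rule [::] ([::] ⊢ One)
| ZeroL Γ Δ C :
    finitary_rule [::] (Γ ++ Zero :: Δ ⊢ C)
| StarR0 A :
    finitary_rule [::] ([::] ⊢ Star A)
| UnderL Γ Π Δ A B C :
    finitary_rule [:: (Π ⊢ A); (Γ ++ B :: Δ ⊢ C)]
                  (Γ ++ Π ++ Under A B :: Δ ⊢ C)
| UnderR Π A B :
    finitary_rule [:: (A :: Π ⊢ B)] (Π ⊢ Under A B)
| OverL Γ Π Δ A B C :
    finitary_rule [:: (Π ⊢ A); (Γ ++ B :: Δ ⊢ C)]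
                  (Γ ++ Over B A :: Π ++ Δ ⊢ C)
| OverR Π A B :
    finitary_rule [:: (Π ++ [:: A] ⊢ B)] (Π ⊢ Over B A)
| ProdL Γ Δ A B C :
    finitary_rule [:: (Γ ++ A :: B :: Δ ⊢ C)] (Γ ++ Prod A B :: Δ ⊢ C)
| ProdR Γ Δ A B :
    finitary_rule [:: (Γ ⊢ A); (Δ ⊢ B)] (Γ ++ Δ ⊢ Prod A B)
| OneL Γ Δ C :
    finitary_rule [:: (Γ ++ Δ ⊢ C)] (Γ ++ One :: Δ ⊢ C)
| PlusL Γ Δ A1 A2 C :
    finitary_rule [:: (Γ ++ A1 :: Δ ⊢ C); (Γ ++ A2 :: Δ ⊢ C)]
                  (Γ ++ Plus A1 A2 :: Δ ⊢ C)
| PlusR1 Π A1 A2 :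
    finitary_rule [:: (Π ⊢ A1)] (Π ⊢ Plus A1 A2)
| PlusR2 Π A1 A2 :
    finitary_rule [:: (Π ⊢ A2)] (Π ⊢ Plus A1 A2)
| WithL1 Γ Δ A1 A2 C :
    finitary_rule [:: (Γ ++ A1 :: Δ ⊢ C)] (Γ ++ With A1 A2 :: Δ ⊢ C)
| WithL2 Γ Δ A1 A2 C :
    finitary_rule [:: (Γ ++ A2 :: Δ ⊢ C)] (Γ ++ With A1 A2 :: Δ ⊢ C)
| WithR Π A1 A2 :
    finitary_rule [:: (Π ⊢ A1); (Π ⊢ A2)] (Π ⊢ With A1 A2)
| StarR (Πs : seq (seq formula)) A :
    0 < size Πs ->
    finitary_rule [seq (Π ⊢ A) | Π <- Πs] (flatten Πs ⊢ Star A)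
| BangL Γ Δ A C :
    finitary_rule [:: (Γ ++ A :: Δ ⊢ C)] (Γ ++ Bang A :: Δ ⊢ C)
| BangR Π B :
    finitary_rule [:: (map Bang Π ⊢ B)] (map Bang Π ⊢ Bang B)
| BangP1 Γ Π Δ A C :
    finitary_rule [:: (Γ ++ Π ++ Bang A :: Δ ⊢ C)] (Γ ++ Bang A :: Π ++ Δ ⊢ C)
| BangP2 Γ Π Δ A C :
    finitary_rule [:: (Γ ++ Bang A :: Π ++ Δ ⊢ C)] (Γ ++ Π ++ Bang A :: Δ ⊢ C)
| BangW Γ Δ A C :
    finitary_rule [:: (Γ ++ Δ ⊢ C)] (Γ ++ Bang A :: Δ ⊢ C)
| BangC Γ Δ A C :
    finitary_rule [:: (Γ ++ Bang A :: Bang A :: Δ ⊢ C)] (Γ ++ Bang A :: Δ ⊢ C).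

Inductive omega_rule : (nat -> sequent) -> sequent -> Prop :=
| StarL Γ Δ A C :
    omega_rule (fun n => Γ ++ nseq n A ++ Δ ⊢ C) (Γ ++ Star A :: Δ ⊢ C).

(* A calculus is given by its rule instances (set of premises, conclusion). *)
Definition calculus : Type := set sequent -> sequent -> Prop.

Inductive derivable_from (L : calculus) (H : set sequent) : sequent -> Prop :=
| derivable_hyp s : H s -> derivable_from L H s
| derivable_rule P s : L P s -> (forall p, P p -> derivable_from L H p) ->
    derivable_from L H s.

Fixpoint star_free (A : formula) : bool :=
  match A with
  | Var _ | Zero | One => true
  | Under A B | Over A B | Prod A B | Plus A B | With A B =>
      star_free A && star_free B
  | Star _ => false
  | Bang A => star_free A
  end.

(* Every subformula [Bang B] has [B] star-free. *)
Fixpoint bang_star_free (A : formula) : bool :=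
  match A with
  | Var _ | Zero | One => true
  | Under A B | Over A B | Prod A B | Plus A B | With A B =>
      bang_star_free A && bang_star_free B
  | Star A => bang_star_free A
  | Bang A => star_free A && bang_star_free A
  end.

Definition minus_sequent : set sequent :=
  [set s | all bang_star_free s.1 && bang_star_free s.2].

Definition minus_restriction (L : calculus) : calculus :=
  fun P s => L P s /\ P `<=` minus_sequent /\ minus_sequent s.

Inductive finitary_instance : calculus :=
| FinitaryInstance ps s : finitary_rule ps s -> finitary_instance [set` ps] s.

Inductive omega_instance : calculus :=
| OmegaInstance p s : omega_rule p s -> omega_instance (range p) s.

Definition ACTm : calculus :=
  minus_restriction (fun P s => finitary_instance P s \/ omega_instance P s).

Inductive fin_instance : calculus :=
| FinInstance (ps : seq sequent) s :
    derivable_from (minus_restriction finitary_instance) [set` ps] s ->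
    fin_instance [set` ps] s.

Definition ACTm_fin : calculus :=
  minus_restriction (fun P s => omega_instance P s \/ fin_instance P s).

Definition immediate_derivability (L : calculus) (S : set sequent) : set sequent :=
  S `|` [set s | exists P, L P s /\ P `<=` S].

Record Ord : Type := MkOrd {
  ord_sort :> Type;
  ord_lt : ord_sort -> ord_sort -> Prop;
  ord_lt_wf : well_founded ord_lt;
  ord_lt_trans : forall x y z, ord_lt x y -> ord_lt y z -> ord_lt x z;
  ord_lt_total : forall x y, ord_lt x y \/ x = y \/ ord_lt y x }.

(* [a] is isomorphic to an initial segment of [b].  Two ordinals are the same
   when [ord_le] holds in both directions, not when they are Leibniz equal. *)
Definition ord_le (a b : Ord) : Prop :=
  exists f : a -> b,
    (forall x y, ord_lt x y -> ord_lt (f x) (f y)) /\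
    (forall x z, ord_lt z (f x) -> exists y, f y = z).

Definition succ_lt (a : Ord) (x y : option a) : Prop :=
  match x, y with
  | Some x, Some y => ord_lt x y
  | Some _, None => True
  | None, _ => False
  end.

Lemma succ_lt_wf (a : Ord) : well_founded (@succ_lt a).
Proof.
have H (x : a) : Acc (@succ_lt a) (Some x).
  elim: (ord_lt_wf x) => {}x _ IH; apply: Acc_intro => -[y yx|[]].
  exact: IH.
by case=> [x|]; [exact: H | apply: Acc_intro => -[y _|[]]; exact: H].
Qed.

Lemma succ_lt_trans (a : Ord) (x y z : option a) :
  succ_lt x y -> succ_lt y z -> succ_lt x z.
Proof. by case: x y z => [x|] [y|] [z|] //=; apply: ord_lt_trans. Qed.

Lemma succ_lt_total (a : Ord) (x y : option a) :
  succ_lt x y \/ x = y \/ succ_lt y x.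
Proof.
case: x y => [x|] [y|] /=; last by right; left.
- by case: (ord_lt_total x y) => [|[->|]];
    [left | right; left | right; right].
- by left.
- by right; right.
Qed.

Definition ord_succ (a : Ord) : Ord :=
  MkOrd (@succ_lt_wf a) (@succ_lt_trans a) (@succ_lt_total a).

(* The element [p] of ω^ω stands for the Cantor normal form with coefficient
   (p`_n)%R at ω^n; normal forms are compared at the largest exponent where they
   differ. *)
Definition omega_omega_lt (p q : {poly nat}) : Prop :=
  exists n, (p`_n)%R < (q`_n)%R /\ forall m, n < m -> (p`_m)%R = (q`_m)%R.

Lemma omega_omega_lt_wf : well_founded omega_omega_lt.
Proof.
suff H n (p : {poly nat}) : size p <= n -> Acc omega_omega_lt p.
  by move=> p; apply: (H (size p)).
elim: n p => [|n IHn] p sp.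
  constructor=> q [m [+ _]].
  by have /size_poly_leq0P -> := sp; rewrite coef0 ltn0.
suff {p sp} H k (p : {poly nat}) :
    size p <= n.+1 -> (p`_n)%R < k -> Acc omega_omega_lt p.
  exact: (H (p`_n)%R.+1).
elim: k p => [|k IHk] p sp; first by rewrite ltn0.
rewrite ltnS => pk.
have Ar : Acc omega_omega_lt (take_poly n p) by apply: IHn; apply: size_take_poly.
move Er : (take_poly n p) Ar => r Ar.
elim: Ar p sp pk Er => {}r _ IHr p sp pk Er.
constructor=> q [m [qp Eqp]].
have mn : m <= n.
  rewrite leqNgt; apply/negP => nm.
  by move: qp; rewrite (leq_sizeP _ _ sp m nm) ltn0.
have sq : size q <= n.+1.
  apply/leq_sizeP => j nj; rewrite Eqp; last exact: leq_ltn_trans nj.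
  exact: (leq_sizeP _ _ sp).
move: mn; rewrite leq_eqVlt => /orP[/eqP mE|mn].
  by apply: IHk => //; apply: leq_trans pk; rewrite -mE.
apply: (IHr (take_poly n q)) => //; last by rewrite Eqp.
exists m; rewrite -Er !coef_take_poly mn; split=> // j mj.
by rewrite !coef_take_poly Eqp.
Qed.

Lemma omega_omega_lt_trans (p q r : {poly nat}) :
  omega_omega_lt p q -> omega_omega_lt q r -> omega_omega_lt p r.
Proof.
move=> [m [pq Epq]] [n [qr Eqr]].
have [mn|nm|mn] := ltngtP m n.
- exists n; split=> [|j nj]; first by rewrite Epq.
  by rewrite Epq ?Eqr // (ltn_trans mn).
- exists m; split=> [|j mj]; first by rewrite -Eqr.
  by rewrite Epq ?Eqr // (ltn_trans nm).
- rewrite -{n}mn in qr Eqr; exists m; split=> [|j mj].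
    exact: ltn_trans pq qr.
  by rewrite Epq ?Eqr.
Qed.

Lemma omega_omega_lt_total (p q : {poly nat}) :
  omega_omega_lt p q \/ p = q \/ omega_omega_lt q p.
Proof.
have [pq|/eqP pq] := eqVneq p q; first by right; left.
have bnd i : (p`_i)%R != (q`_i)%R -> i <= maxn (size p) (size q).
  rewrite leqNgt; apply: contra; rewrite gtn_max => /andP[pi qi].
  by rewrite !nth_default // ltnW.
have ex : exists i, (p`_i)%R != (q`_i)%R.
  apply: contrapT => ne; apply: pq; apply/polyP => i.
  by apply/eqP; apply: contrapT => /negP ni; apply: ne; exists i.
have [n nE nmax] := ex_maxnP ex bnd.
have E m : n < m -> (p`_m)%R = (q`_m)%R.
  by move=> nm; apply/eqP; apply: contraTT nm; rewrite -leqNgt; apply: nmax.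
move: nE; rewrite neq_ltn => /orP[lt|lt]; [left | right; right].
  by exists n.
by exists n; split=> // m /E.
Qed.

Definition omega_omega : Ord :=
  MkOrd omega_omega_lt_wf omega_omega_lt_trans omega_omega_lt_total.

Definition ord_is_zero (a : Ord) (x : a) : Prop := forall y, ~ ord_lt y x.

(* [x] is the immediate successor of [y]. *)
Definition ord_covers (a : Ord) (x y : a) : Prop :=
  ord_lt y x /\ forall z, ~ (ord_lt y z /\ ord_lt z x).

Definition ord_is_limit (a : Ord) (x : a) : Prop :=
  ~ ord_is_zero x /\ forall y, ~ ord_covers x y.

Lemma ord_lt_irrefl (a : Ord) (x : a) : ~ ord_lt x x.
Proof. by elim: (ord_lt_wf x) => {}x _ IH xx; apply: (IH x). Qed.

Section Iteration.
Context {T : Type}.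
Implicit Types (F : set T -> set T) (S : set T) (a : Ord).

(* [stage F S x] is F^ξ(S) for the order type ξ of the elements below [x];
   see [stage_zero], [stage_succ], [stage_limit]. *)
Definition stage_step F S a (x : a)
    (stage : forall y, ord_lt y x -> set T) : set T :=
  [set t | (ord_is_zero x /\ S t) \/
           (exists y (xy : ord_covers x y), F (stage y xy.1) t) \/
           (ord_is_limit x /\ exists y (yx : ord_lt y x), stage y yx t)].

Definition stage F S a : a -> set T :=
  Fix (@ord_lt_wf a) (fun _ => set T) (@stage_step F S a).

Lemma stageE F S a (x : a) :
  stage F S x = stage_step F S (fun y (_ : ord_lt y x) => stage F S y).
Proof.
rewrite /stage Fix_eq // => {}x f g fg.
congr stage_step; apply: functional_extensionality_dep => y.
by apply: functional_extensionality_dep => yx; apply: fg.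
Qed.

Lemma stage_zero F S a (x : a) : ord_is_zero x -> stage F S x = S.
Proof.
move=> x0; rewrite stageE; apply/seteqP; split=> t; last by left.
by case=> [[]//|[[y [/[dup] [[/x0]]]]|[[]]]].
Qed.

Lemma stage_succ F S a (x y : a) :
  ord_covers x y -> stage F S x = F (stage F S y).
Proof.
move=> xy; rewrite stageE; apply/seteqP; split=> t; last first.
  by right; left; exists y, xy.
case=> [[/(_ y) []]|[[z [xz]]|[[_ /(_ y)]]]] //; first exact: xy.1.
suff -> : z = y by [].
case: (ord_lt_total z y) => [zy|[//|yz]].
  by case: (xz.2 y); split=> //; exact: xy.1.
by case: (xy.2 z); split=> //; exact: xz.1.
Qed.

Lemma stage_limit F S a (x : a) : ord_is_limit x ->
  stage F S x = \bigcup_(y in [set y | ord_lt y x]) stage F S y.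
Proof.
move=> xl; rewrite stageE; apply/seteqP; split=> t.
  case=> [[/xl.1]//|[[y [/[dup] /xl.2]]//|[_ [y [yx ty]]]]].
  by exists y.
by move=> [y yx ty]; right; right; split=> //; exists y, yx.
Qed.

(* F^a(S): in the successor of [a], the elements below the top [None] form [a]. *)
Definition ord_iter F a S : set T := stage F S (None : ord_succ a).

Lemma stage_initial F S (a b : Ord) (f : a -> b) :
  (forall x y, ord_lt x y -> ord_lt (f x) (f y)) ->
  (forall x z, ord_lt z (f x) -> exists y, f y = z) ->
  forall x, stage F S (f x) = stage F S x.
Proof.
move=> fmono finit.
have frefl x y : ord_lt (f x) (f y) -> ord_lt x y.
  move=> fxy; case: (ord_lt_total x y) => [//|[xy|/fmono fyx]].
    by rewrite xy in fxy; case: (ord_lt_irrefl fxy).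
  by case: (ord_lt_irrefl (ord_lt_trans fxy fyx)).
have fcov x y : ord_covers x y -> ord_covers (f x) (f y).
  move=> [yx xmin]; split; first exact: fmono.
  move=> z [yz zx]; have [w wz] := finit _ _ zx; rewrite -wz in yz zx.
  by apply: (xmin w); split; apply: frefl.
move=> x; elim: (ord_lt_wf x) => {}x _ IH.
have [x0|xn0] := pselect (ord_is_zero x).
  rewrite !stage_zero // => z zx; have [w wz] := finit _ _ zx.
  by apply: (x0 w); apply: frefl; rewrite wz.
have [[y xy]|xns] := pselect (exists y, ord_covers x y).
  by rewrite (stage_succ _ _ xy) (stage_succ _ _ (fcov _ _ xy)) IH //; apply: xy.1.
have xl : ord_is_limit x by split=> // y xy; apply: xns; exists y.
have fxl : ord_is_limit (f x).
  split=> [fx0|z [zx zmax]].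
    by apply: xn0 => y /fmono; apply: fx0.
  have [y yz] := finit _ _ zx; rewrite -yz in zx zmax.
  apply: xns; exists y; split=> [|w [yw wx]]; first exact: frefl.
  by apply: (zmax (f w)); split; apply: fmono.
rewrite !stage_limit //; apply/seteqP; split=> t [y /= yx ty].
  have [w wy] := finit _ _ yx; rewrite -wy in yx ty.
  by exists w; [exact: frefl | rewrite -IH //; exact: frefl].
by exists (f y); [exact: fmono | rewrite /= IH].
Qed.

Lemma ord_iter_succ F S a : ord_iter F (ord_succ a) S = F (ord_iter F a S).
Proof.
rewrite {1}/ord_iter (@stage_succ _ _ (ord_succ (ord_succ a)) None (Some None)); last first.
  by split=> // -[[z|]|] [].
congr (F _); apply: (@stage_initial F S (ord_succ a) (ord_succ (ord_succ a)) Some).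
  by [].
by move=> x [z|] //; exists z.
Qed.

Definition is_closure_ordinal F a : Prop :=
  ord_iter F (ord_succ a) set0 = ord_iter F a set0 /\
  forall b, ord_iter F (ord_succ b) set0 = ord_iter F b set0 -> ord_le a b.

End Iteration.

(* Main.v *)
(* Count the stars of a sequent that lie outside every [Bang], giving weight
   ω^h to a star whose argument has star height h, and combine the weights by the
   natural (Hessenberg) sum.  Since everything under a [Bang] is star-free, no
   finitary rule, contraction included, has a premise heavier than its
   conclusion, and the omega rule makes the weight strictly smaller.  Hence a
   derivable sequent of weight μ appears before stage ω·(μ + 1): the finitary
   rules below the last omega rules cost finitely many stages, while the
   premises of those omega rules have appeared before stage ω·μ.  Such stages
   are below ω^ω. *)

From mathcomp Require Import all_boot ssralg poly zify.
From mathcomp Require Import boolp classical_sets.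
Require Import Defs.

Set Implicit Arguments.
Unset Strict Implicit.
Unset Printing Implicit Defensive.

Import GRing.Theory.

Local Open Scope classical_set_scope.

(** * Comparability of ordinals *)

Lemma ord_min (a : Ord) (P : a -> Prop) :
  (exists x, P x) -> exists x, P x /\ forall y, ord_lt y x -> ~ P y.
Proof.
case=> x; elim: (ord_lt_wf x) => {}x _ IH Px.
have [[y [yx Py]]|none] := pselect (exists y, ord_lt y x /\ P y).
  exact: IH yx Py.
by exists x; split=> // y yx Py; apply: none; exists y.
Qed.

Section Comparability.
Variables a b : Ord.

Definition ord_bisim (R : a -> b -> Prop) : Prop :=
  forall x y, R x y ->
    (forall x', ord_lt x' x -> exists2 y', ord_lt y' y & R x' y') /\
    (forall y', ord_lt y' y -> exists2 x', ord_lt x' x & R x' y').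

(* The initial segments below [x] and below [y] have the same order type. *)
Definition ord_match (x : a) (y : b) : Prop := exists2 R, ord_bisim R & R x y.

Lemma ord_match_bisim : ord_bisim ord_match.
Proof.
move=> x y [R bR Rxy]; have [Rl Rr] := bR _ _ Rxy.
split=> [x' /Rl[y' y'y Rxy']|y' /Rr[x' x'x Rxy']].
  by exists y' => //; exists R.
by exists x' => //; exists R.
Qed.

(** Induction on [x]: were [y] below [y'], some [u] below [x] would match [y], and also some [v]
    below [y]; by induction [v = y], which is absurd. *)
Lemma ord_match_fun x y y' : ord_match x y -> ord_match x y' -> y = y'.
Proof.
elim: (ord_lt_wf x) y y' => {}x _ IH.
have H y y' : ord_match x y -> ord_match x y' -> ~ ord_lt y y'.
  move=> /ord_match_bisim[xy _] /ord_match_bisim[_ xy'] /xy'[u ux uy].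
  have [v vy uv] := xy _ ux.
  by move: vy; rewrite (IH _ ux _ _ uv uy); apply: ord_lt_irrefl.
move=> y y' xy xy'; case: (ord_lt_total y y') => [|[//|]] /H.
- by move=> /(_ xy xy').
- by move=> /(_ xy' xy).
Qed.

Lemma ord_match_inj x x' y : ord_match x y -> ord_match x' y -> x = x'.
Proof.
have H u u' v : ord_match u v -> ord_match u' v -> ~ ord_lt u u'.
  move=> uv /ord_match_bisim[u'v _] /u'v[w wv uw].
  by move: wv; rewrite (ord_match_fun uw uv); apply: ord_lt_irrefl.
move=> xy xy'; case: (ord_lt_total x x') => [|[//|]] /H.
- by move=> /(_ _ xy xy').
- by move=> /(_ _ xy' xy).
Qed.

Lemma ord_match_lt x x' y y' :
  ord_match x y -> ord_match x' y' -> ord_lt x x' <-> ord_lt y y'.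
Proof.
move=> xy xy'; have [l r] := ord_match_bisim xy'; split.
  by move=> /l[z zy /ord_match_fun/(_ xy) <-].
by move=> /r[z zx /ord_match_inj/(_ xy) <-].
Qed.

(** Adjoining the pair [(x, y)] to [ord_match] leaves it a bisimulation. *)
Lemma ord_match_extend x y :
  (forall x', ord_lt x' x -> exists2 y', ord_lt y' y & ord_match x' y') ->
  (forall y', ord_lt y' y -> exists2 x', ord_lt x' x & ord_match x' y') ->
  ord_match x y.
Proof.
move=> l r; exists (fun u v => ord_match u v \/ (u = x /\ v = y)); last by right.
move=> u v [/ord_match_bisim[ul ur]|[-> ->]]; split=> w.
- by move=> /ul[z]; exists z => //; left.
- by move=> /ur[z]; exists z => //; left.
- by move=> /l[z]; exists z => //; left.
- by move=> /r[z]; exists z => //; left.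
Qed.

(** If all of [a] is matched, choice yields the embedding. Otherwise take the least unmatched [x0]:
    the elements below it are matched with exactly those of [b], and the top of [ord_succ b] goes to
    [x0]. *)
Lemma ord_le_or_succ_le : ord_le a b \/ ord_le (ord_succ b) a.
Proof.
have [all_a|/existsNP/ord_min] := pselect (forall x, exists y, ord_match x y).
  have [f fE] := choice all_a; left; exists f.
  split=> [x y xy|x z zx]; first exact/(ord_match_lt (fE x) (fE y)).
  have [_ /(_ _ zx)[y _ yz]] := ord_match_bisim (fE x).
  by exists y; apply: ord_match_fun yz.
case=> x0 [x0N x0min]; right.
have lt_x0 x : ord_lt x x0 -> exists y, ord_match x y.
  by move=> /x0min /contrapT.
have all_b y : exists x, ord_lt x x0 /\ ord_match x y.
  apply: contrapT => yN.
  (* The least [y0] without a partner below [x0] would match [x0] itself. *)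
  have [y0 [y0N y0min]] := ord_min (ex_intro (fun y => ~ _) y yN).
  apply: x0N; exists y0; apply: ord_match_extend => [x xx0|z zy0]; last first.
    by have /contrapT[x []] := y0min _ zy0; exists x.
  have [z xz] := lt_x0 _ xx0; exists z => //.
  case: (ord_lt_total z y0) => [//|[zy0|y0z]]; case: y0N.
    by exists x; rewrite -zy0.
  have [_ /(_ _ y0z)[w wx wy0]] := ord_match_bisim xz.
  by exists w; split=> //; apply: ord_lt_trans xx0.
have [g gE] := choice all_b.
have [gx0 gm] : (forall y, ord_lt (g y) x0) /\ forall y, ord_match (g y) y.
  by split=> y; case: (gE y).
exists (fun y => if y is Some y then g y else x0); split.
  by move=> [x|] [y|] //= xy; apply/(ord_match_lt (gm x) (gm y)).
move=> y z zy.
have /lt_x0[w zw] : ord_lt z x0.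
  by case: y zy => // y /ord_lt_trans; apply.
by exists (Some w); apply: ord_match_inj zw.
Qed.

End Comparability.

(** * Initial segments as ordinals *)

Section InitialSegment.
Variables (a : Ord) (x : a).

Definition segment_lt (u v : {y : a | ord_lt y x}) : Prop :=
  ord_lt (sval u) (sval v).

Lemma segment_lt_wf : well_founded segment_lt.
Proof.
case=> y; elim: (ord_lt_wf y) => {}y _ IH yx.
by constructor=> -[z zx] zy; apply: IH.
Qed.

Lemma segment_lt_trans u v w :
  segment_lt u v -> segment_lt v w -> segment_lt u w.
Proof. exact: ord_lt_trans. Qed.

Lemma segment_lt_total u v : segment_lt u v \/ u = v \/ segment_lt v u.
Proof.
case: (ord_lt_total (sval u) (sval v)) => [|[/eq_sig_hprop|]];
  [by left | | by right; right].
by move=> uv; right; left; apply: uv => y p q; apply: Prop_irrelevance.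
Qed.

Definition ord_segment : Ord :=
  MkOrd segment_lt_wf segment_lt_trans segment_lt_total.

Lemma stage_segment T (F : set T -> set T) S (u : ord_segment) :
  stage F S u = stage F S (sval u).
Proof.
symmetry; apply: (@stage_initial _ F S ord_segment a sval) => // -[y yx] z zy.
by exists (exist _ z (ord_lt_trans zy yx)).
Qed.

Lemma ord_iter_segment T (F : set T -> set T) S :
  ord_iter F ord_segment S = stage F S x.
Proof.
pose f (u : ord_succ ord_segment) := if u is Some y then sval y else x.
rewrite /ord_iter -(@stage_initial _ F S _ a f) //.
  by case=> [[u ux]|] [[v vx]|].
move=> u z zu; have zx : ord_lt z x.
  by case: u zu => [[u ux]|//] zu; apply: ord_lt_trans zu ux.
by exists (Some (exist _ z zx)).
Qed.

End InitialSegment.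

(** * Closure ordinals and growth of stages *)

(** The closure ordinal is realized as the segment below the least fixed stage [x] of
    [ord_succ w]. *)
Lemma closure_ordinal_le T (F : set T -> set T) (w : Ord) :
  ord_iter F (ord_succ w) set0 = ord_iter F w set0 ->
  exists a, is_closure_ordinal F a /\ ord_le a w.
Proof.
rewrite ord_iter_succ => fixw.
have [x [fixx minx]] := ord_min (ex_intro
  (fun y : ord_succ w => F (stage F set0 y) = stage F set0 y) None fixw).
exists (ord_segment x); split; last first.
  (* Nothing below [x] is the top [None], so the segment embeds into [w]. *)
  have neN (u : ord_segment x) : exists y, sval u = Some y.
    by case: u => -[y|] /= ux; [exists y | case: (x) ux].
  have [f fE] := choice neN.
  exists f; split=> [u v|u z zu]; first by rewrite /= /segment_lt !fE.
  have zx : @ord_lt (ord_succ w) (Some z) x.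
    have := svalP u; rewrite fE.
    exact: (@ord_lt_trans (ord_succ w) (Some z) (Some (f u)) x zu).
  exists (exist _ (Some z) zx).
  by have := fE (exist _ (Some z) zx) => -[].
split; first by rewrite ord_iter_succ ord_iter_segment.
move=> b; rewrite ord_iter_succ => fixb.
have [//|[f [fmono finit]]] := ord_le_or_succ_le (ord_segment x) b.
(* Otherwise [ord_succ b] embeds into the segment, and the image of its top is a fixed stage below
   [x]. *)
case: (minx (sval (f None))); first exact: (svalP (f None)).
by rewrite -stage_segment (stage_initial _ _ fmono finit).
Qed.

(** Induction on [y]: if [y] covers [z], then [x] is [z] or lies below it; if [y] covers nothing, it
    is a limit and some [z] lies strictly between. *)
Lemma stage_step_sub T (F : set T -> set T) S (a : Ord) (x y : a) :
  (forall X, X `<=` F X) -> ord_lt x y -> F (stage F S x) `<=` stage F S y.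
Proof.
move=> Finfl; elim: (ord_lt_wf y) x => {}y _ IH x xy.
have [[z yz]|yN] := pselect (exists z, ord_covers y z).
  rewrite (stage_succ _ _ yz).
  case: (ord_lt_total x z) => [xz|[->//|zx]]; last by case: (yz.2 x).
  exact: subset_trans (IH _ yz.1 _ xz) (Finfl _).
have [z [xz zy]] : exists z, ord_lt x z /\ ord_lt z y.
  by apply: contrapT => zN; apply: yN; exists x; split=> // z [xz zy]; apply: zN; exists z.
rewrite (@stage_limit _ _ _ _ y).
  by move=> t Ft; exists z => //; apply: (IH z zy x xz).
by split=> [/(_ x)//|u yu]; apply: yN; exists u.
Qed.

Lemma stage_sub T (F : set T -> set T) S (a : Ord) (x y : a) :
  (forall X, X `<=` F X) -> ord_lt x y -> stage F S x `<=` stage F S y.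
Proof. by move=> Finfl xy; exact: subset_trans (@Finfl _) (stage_step_sub Finfl xy). Qed.

(** * Stages and derivability *)

Section Derivability.
Implicit Types (L : calculus) (H : set sequent).

Lemma derivable_from_trans L L' H H' s :
  (forall P s, L P s -> L' P s) ->
  (forall h, H h -> derivable_from L' H' h) ->
  derivable_from L H s -> derivable_from L' H' s.
Proof.
move=> LL' HH'; elim=> [{}s /HH'//|P {}s /LL' LP _ IH].
exact: derivable_rule LP IH.
Qed.

Lemma immediate_infl L (X : set sequent) : X `<=` immediate_derivability L X.
Proof. by left. Qed.

Lemma stage_rule L S (a : Ord) (x y : a) P s : ord_lt x y -> L P s ->
  P `<=` stage (immediate_derivability L) S x ->
  stage (immediate_derivability L) S y s.
Proof.
move=> xy LP Px; apply: (stage_step_sub (@immediate_infl L) xy).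
by right; exists P.
Qed.

Lemma immediate_derivable L S s :
  (forall t, S t -> derivable_from L set0 t) ->
  immediate_derivability L S s -> derivable_from L set0 s.
Proof.
move=> HS [/HS//|[P [LP PS]]].
by apply: derivable_rule LP _ => p /PS /HS.
Qed.

Lemma stage_derivable L (a : Ord) (x : a) s :
  stage (immediate_derivability L) set0 x s -> derivable_from L set0 s.
Proof.
elim: (ord_lt_wf x) s => {}x _ IH s; rewrite stageE.
case=> [[_ []]|[[y [[yx _] /=]]|[_ [y [yx]]]]]; last exact: IH.
by apply: immediate_derivable => t; apply: IH.
Qed.

End Derivability.

(** * Weights of formulas, sequents and rules *)

(** Polynomials encode Cantor normal forms, and their sum is the Hessenberg sum. As natural
    coefficients never cancel, the [size] is the star height outside every [Bang]. *)
Fixpoint star_weight (A : formula) : {poly nat} :=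
  match A with
  | Var _ | Zero | One | Bang _ => 0%R
  | Under A B | Over A B | Prod A B | Plus A B | With A B =>
      (star_weight A + star_weight B)%R
  | Star A => (star_weight A + 'X^(size (star_weight A)))%R
  end.

Definition seq_weight (G : seq formula) : {poly nat} :=
  (\sum_(A <- G) star_weight A)%R.

Definition sequent_weight (s : sequent) : {poly nat} :=
  (seq_weight s.1 + star_weight s.2)%R.

Lemma star_free_weight A : star_free A -> star_weight A = 0%R.
Proof.
elim: A => //= A IHA B IHB /andP[/IHA-> /IHB->]; exact: addr0.
Qed.

Lemma seq_weight_cat G D : seq_weight (G ++ D) = (seq_weight G + seq_weight D)%R.
Proof. exact: big_cat. Qed.

Lemma seq_weight_cons A D : seq_weight (A :: D) = (star_weight A + seq_weight D)%R.
Proof. exact: big_cons. Qed.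

Lemma seq_weight_nil : seq_weight [::] = 0%R.
Proof. exact: big_nil. Qed.

Lemma coef_seq_weight_nseq n A i :
  ((seq_weight (nseq n A))`_i)%R = n * ((star_weight A)`_i)%R.
Proof.
elim: n => [|n IH]; first by rewrite seq_weight_nil coef0.
by rewrite /= seq_weight_cons coefD IH mulSn.
Qed.

Lemma coefD_nat (p q : {poly nat}) i : ((p + q)`_i)%R = (p`_i)%R + (q`_i)%R.
Proof. exact: coefD. Qed.

Lemma coef0_nat i : ((0 : {poly nat})`_i)%R = 0.
Proof. exact: coef0. Qed.

Definition weightE := (seq_weight_cat, seq_weight_cons, seq_weight_nil,
  coefD_nat, coef0_nat).

Lemma seq_weight_Bang G : seq_weight (map Bang G) = 0%R.
Proof.
by elim: G => [|A G IH] /=; rewrite ?seq_weight_nil // seq_weight_cons IH addr0.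
Qed.

Lemma coef_seq_weight_flatten G Gs i : G \in Gs ->
  ((seq_weight G)`_i)%R <= ((seq_weight (flatten Gs))`_i)%R.
Proof.
elim: Gs => //= D Gs IH; rewrite inE !weightE.
case/orP => [/eqP->|/IH GGs]; first exact: leq_addr.
exact: leq_trans GGs (leq_addl _ _).
Qed.

(** Comparing coefficients one at a time reduces each rule to linear arithmetic. *)
Lemma finitary_rule_weight ps s p i : finitary_rule ps s ->
  minus_sequent s -> p \in ps ->
  ((sequent_weight p)`_i)%R <= ((sequent_weight s)`_i)%R.
Proof.
rewrite /sequent_weight; case=> {ps s}.
(* In turn [StarR], [BangL] and [BangR], each being goal 18 once the previous one is closed. The
   last two rely on star-freeness under [Bang]. *)
18: {
  move=> Gs A _ _ /mapP[G GGs ->] /=; rewrite !weightE.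
  apply: leq_add; first exact: coef_seq_weight_flatten.
  exact: leq_addr. }
18: {
  move=> G D A C; rewrite /minus_sequent /= all_cat /= inE.
  move=> /andP[/and3P[_ /andP[/star_free_weight A0 _] _] _] /eqP->.
  by rewrite !weightE /= A0 weightE; lia. }
18: {
  move=> G B; rewrite /minus_sequent /= => /andP[_ /andP[/star_free_weight B0 _]].
  by rewrite inE => /eqP-> /=; rewrite seq_weight_Bang B0. }
all: move=> *; match goal with H : is_true (_ \in _) |- _ => move: H end.
all: rewrite ?inE //.
all: repeat (case/orP; first (move=> /eqP->;
  rewrite /= !weightE /= -/star_weight ?weightE; lia)).
all: by move=> /eqP->; rewrite /= !weightE /= -/star_weight ?weightE; lia.
Qed.

Lemma coef_le_omega_omega (p q : {poly nat}) :
  (forall i, (p`_i)%R <= (q`_i)%R) -> p = q \/ omega_omega_lt p q.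
Proof.
move=> pq; case: (omega_omega_lt_total p q) => [|[|[n [qp _]]]]; [by right|by left|].
by have := pq n; rewrite leqNgt qp.
Qed.

Lemma omega_rule_weight f s n : omega_rule f s ->
  omega_omega_lt (sequent_weight (f n)) (sequent_weight s).
Proof.
(* At this exponent the copies of [A] contribute 0 while [Star A] contributes 1; above it both
   contribute 0. *)
case=> G D A C; exists (size (star_weight A)); rewrite /sequent_weight.
have A0 m : size (star_weight A) <= m -> ((star_weight A)`_m)%R = 0.
  exact: nth_default.
split=> [|m ltm]; rewrite !weightE coef_seq_weight_nseq /= -/star_weight.
  by rewrite ?coefD_nat coefXn eqxx A0 //= mulr1n; lia.
by rewrite ?coefD_nat coefXn gtn_eqF // A0 ?(ltnW ltm) //= mulr0n; lia.
Qed.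

(** * Stages below ω^ω *)

(* The ordinal ω·p + k. *)
Definition omega_mul_add (p : {poly nat}) (k : nat) : omega_omega :=
  ('X * p + k%:P)%R.

Lemma coef_omega_mul_add p k i :
  ((omega_mul_add p k : {poly nat})`_i)%R = if i is j.+1 then (p`_j)%R else k.
Proof.
rewrite /omega_mul_add coefD_nat coefXM coefC.
by case: i => [|i] /=; rewrite ?addn0.
Qed.

Lemma omega_mul_add_ltr p j k : j < k ->
  ord_lt (omega_mul_add p j) (omega_mul_add p k).
Proof.
by move=> jk; exists 0; rewrite !coef_omega_mul_add; split=> // -[|m] // _;
  rewrite !coef_omega_mul_add.
Qed.

Lemma omega_mul_add_ltl p q j k : omega_omega_lt p q ->
  ord_lt (omega_mul_add p j) (omega_mul_add q k).
Proof.
move=> [n [pq Epq]]; exists n.+1; rewrite !coef_omega_mul_add; split=> // -[|m] //.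
by rewrite !coef_omega_mul_add; apply: Epq.
Qed.

(** A general [L] containing the rules of [ACTm] lets one argument serve both calculi. *)
Lemma derivable_stage (L : calculus) s :
  (forall P s, ACTm P s -> L P s) -> derivable_from ACTm set0 s ->
  exists k, stage (immediate_derivability L) set0
    (omega_mul_add (sequent_weight s) k) s.
Proof.
move=> LACT; elim=> {s} [//|P s LP _ IH].
have sub := @stage_sub _ _ set0 omega_omega _ _ (@immediate_infl L).
case: LP (LACT _ _ LP) IH => -[]; last first.
  (* The premises are strictly lighter, so whatever their finite parts they appear by stage ω·μ + 0,
     where μ is the weight of [s]. *)
  case=> {P s} [f s fs] _ Ls IH; exists 1.
  apply: (stage_rule (omega_mul_add_ltr _ (ltnSn 0)) Ls).
  move=> _ [n _ <-]; have [|k] := IH (f n); first by exists n.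
  exact/sub/omega_mul_add_ltl/omega_rule_weight.
case=> {P s} [ps s pss] [_ ms] Ls IH.
have weight p : p \in ps -> sequent_weight p = sequent_weight s \/
    omega_omega_lt (sequent_weight p) (sequent_weight s).
  by move=> pin; apply: coef_le_omega_omega => i; apply: finitary_rule_weight pss _ _.
suff [k kP] : exists k, forall p, p \in ps ->
    stage (immediate_derivability L) set0 (omega_mul_add (sequent_weight s) k) p.
  by exists k.+1; apply: (stage_rule (omega_mul_add_ltr _ (ltnSn k)) Ls).
have {}IH p : p \in ps -> exists k, forall j, k <= j ->
    stage (immediate_derivability L) set0 (omega_mul_add (sequent_weight s) j) p.
  (* The successor [k.+1] makes the inequality strict, as [stage_sub] requires, when premise and
     conclusion weigh the same. *)
  move=> pin; have [k kp] := IH p pin; exists k.+1 => j kj.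
  apply: sub kp; case: (weight p pin) => [->|]; first exact: omega_mul_add_ltr.
  exact: omega_mul_add_ltl.
(* Finitely many premises have a common bound. *)
elim: ps {pss weight Ls} IH => [|p ps IHps] H; first by exists 0.
have [|k kP] := IHps; first by move=> q qps; apply: H; rewrite inE qps orbT.
have [|j jP] := H p; first exact: mem_head.
exists (maxn j k.+1) => q; rewrite inE => /orP[/eqP->|/kP].
  by apply: jP; apply: leq_maxl.
by apply/sub/omega_mul_add_ltr; apply: leq_maxr.
Qed.

(** Stages contain only derivable sequents, and each of these appears below ω^ω, so stage ω^ω is
    already fixed. *)
Lemma closure_ordinal_le_omega_omega (L : calculus) :
  (forall P s, ACTm P s -> L P s) ->
  (forall s, derivable_from L set0 s -> derivable_from ACTm set0 s) ->
  exists a, is_closure_ordinal (immediate_derivability L) a /\ ord_le a omega_omega.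
Proof.
move=> ACTmL LACTm; apply: closure_ordinal_le; rewrite ord_iter_succ.
apply/seteqP; split; last exact: immediate_infl.
move=> s /(immediate_derivable (@stage_derivable _ _ _))/LACTm.
move=> /(derivable_stage ACTmL)[k].
rewrite /ord_iter -(@stage_initial _ _ _ _ (ord_succ omega_omega) Some) //.
  by apply: (stage_sub (@immediate_infl L)).
by move=> x [y|] // _; exists y.
Qed.

(** * Comparison of the two calculi *)

Lemma ACTm_in_fin P s : ACTm P s -> ACTm_fin P s.
Proof.
case=> -[]; last by move=> Ps mPs; split=> //; left.
case=> {P s} [ps s pss] [mps ms]; split=> //; right; constructor.
apply: (@derivable_rule _ _ [set` ps]); first by split=> //; constructor.
exact: derivable_hyp.
Qed.

(** Each instance of (Fin) unfolds into the finitary derivation that it abbreviates. *)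
Lemma ACTm_fin_derivable s :
  derivable_from ACTm_fin set0 s -> derivable_from ACTm set0 s.
Proof.
elim=> {s} [//|P s [[Ps|[ps {}s pss]] mPs] _ IH].
  by apply: derivable_rule IH; split=> //; right.
by apply: derivable_from_trans IH pss => Q t [Qt mQt]; split=> //; left.
Qed.

Theorem theorem5p2 :
  (exists a : Ord,
      is_closure_ordinal (immediate_derivability ACTm_fin) a /\
      ord_le a omega_omega) /\
  (exists a : Ord,
      is_closure_ordinal (immediate_derivability ACTm) a /\
      ord_le a omega_omega).
Proof.
split; apply: closure_ordinal_le_omega_omega => //.
- exact: ACTm_in_fin.
- exact: ACTm_fin_derivable.
Qed.
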